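(* There is no family of Riemannian metrics $g^{(k,m)}$ on $\mathbb{R}_+^{k\times m}$, for each $k\ge 1$ and $m\ge 2$, for which every conditional embedding $f\in\hat{\mathcal{F}}_{k,m}^{l,n}$ is an isometry. Likewise, there is no family of Riemannian metrics $g^{(k,m)}$ on $(\Delta_{m-1}^{k})^\circ$, for each $k\ge 1$ and $m\ge 2$, for which every conditional embedding $f\in\hat{\mathcal{F}}_{k,m}^{l,n}$ (restricted to a map $(\Delta_{m-1}^k)^\circ\to(\Delta_{n-1}^l)^\circ$) is an isometry.
   Context: $\mathbb{R}_+$ is the set of strictly positive reals and $\mathbb{R}_+^{k\times m}$ the set of $k\times m$ matrices with strictly positive entries. $(\Delta_{m-1}^k)^\circ$ is the set of $k\times m$ matrices with strictly positive entries all of whose rows sum to $1$ (the relative interior of the polytope of row-stochastic matrices). Stochastic partition matrix: a matrix $Q\in\mathbb{R}^{m\times n}$ with non-negative entries such that there is a partition $\{A_1,\dots,A_m\}$ of $\{1,\dots,n\}$ into $m$ (non-empty) blocks with $\sum_{j\in A_{i'}}Q_{ij}=\delta_{ii'}$ for all $i,i'$. (Since the maps below take values in strictly positive matrices, the entries $Q_{ij}$ with $j\in A_i$ are strictly positive.) Partition indicator matrix: a matrix $\overline R\in\{0,1\}^{k\times l}$ such that there is a partition $\{A_1,\dots,A_k\}$ of $\{1,\dots,l\}$ into $k$ (non-empty) blocks with $\overline R_{ij}=1$ if $j\in A_i$ and $\overline R_{ij}=0$ otherwise. Row product: for $M\in\mathbb{R}^{k\times m}$ and a collection $Q=\{Q^{(1)},\dots,Q^{(k)}\}$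 of $m\times n$ matrices, $M\otimes Q$ is the $k\times n$ matrix with $(M\otimes Q)_{ab}=(M\cdot Q^{(a)})_{ab}$, i.e. the $a$-th row of $M$ is multiplied by $Q^{(a)}$. Conditional embedding: given a $k\times l$ partition indicator matrix $\overline R$ and a collection $Q=\{Q^{(i)}\}_{i=1}^k$ of $m\times n$ stochastic partition matrices, the map $f:\mathbb{R}_+^{k\times m}\to\mathbb{R}_+^{l\times n}$, $f(M)=\overline R^\top(M\otimes Q)$. The set of all such maps is denoted $\hat{\mathcal{F}}_{k,m}^{l,n}$. Such maps preserve row sums and so map $(\Delta_{m-1}^k)^\circ$ to $(\Delta_{n-1}^l)^\circ$. An embedding $f:(\mathcal E,g)\to(\mathcal E',g')$ is called an isometry if $g=f^*g'$, where $(f^*g')_p(u,v)=g'_{f(p)}(f_*u,f_*v)$ for all points $p$ and tangent vectors $u,v$ at $p$. *)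

(* Defs.v *)
(* MathComp / MathComp-Analysis *)
From HB Require Import structures.
From mathcomp Require Import all_boot all_order all_algebra.
From mathcomp Require Import boolp classical_sets functions reals topology.
From mathcomp Require Import normedtype derive.
Set Implicit Arguments.
Unset Strict Implicit.
Unset Printing Implicit Defensive.
Import Order.TTheory GRing.Theory Num.Theory.
Import numFieldNormedType.Exports.

Local Open Scope classical_set_scope.
Local Open Scope ring_scope.

(* Throughout, a manifold is a subset [E] of a normed space [V], relatively
   open in an affine subspace with direction [T]; the tangent space at every
   point of [E] is then [T]. *)

(* C^n functions on [E].  Since [E] is relatively open, [p + h v] stays in [E]
   for [p] in [E], [v] in [T] and [h] small, so only the values of [F] on [E]
   matter. *)
Fixpoint Cn (R : realType) (V : normedModType R) (E T : set V) (n : nat)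
    (F : V -> R) : Prop :=
  {within E, continuous F} /\
  if n is n'.+1 then
    forall v, T v -> (forall p, E p -> derivable F p v) /\ Cn E T n' ('D_v F)
  else True.

Definition smooth (R : realType) (V : normedModType R) (E T : set V)
    (F : V -> R) : Prop := forall n, Cn E T n F.

(* The values of [g p u v] with [p] outside [E], or with [u] or [v] outside
   [T], are irrelevant.  As the tangent space is constant, smoothness of the
   metric is tested on constant vector fields. *)
Record riemannian_metric (R : realType) (V : normedModType R) (E T : set V)
    (g : V -> V -> V -> R) : Prop := RiemannianMetric {
  metric_linear : forall p u v w (a : R), E p -> T u -> T v -> T w ->
    g p (a *: u + v) w = a * g p u w + g p v w;
  metric_sym : forall p u v, E p -> T u -> T v -> g p u v = g p v u;
  metric_gt0 : forall p u, E p -> T u -> u != 0 -> 0 < g p u u;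
  metric_smooth : forall u v, T u -> T v -> smooth E T (fun p => g p u v)
}.

(* The push-forward is the Fréchet differential in the ambient space. *)
Definition is_isometry (R : realType) (V W : normedModType R) (E T : set V)
    (g : V -> V -> V -> R) (g' : W -> W -> W -> R) (f : V -> W) : Prop :=
  forall p u v, E p -> T u -> T v ->
    g p u v = g' (f p) ('d f p u) ('d f p v).

Definition pos_mx (R : realType) (k m : nat) : set 'M[R]_(k, m) :=
  [set M | forall i j, 0 < M i j].

Definition stoch_int (R : realType) (k m : nat) : set 'M[R]_(k, m) :=
  [set M | (forall i j, 0 < M i j) /\ (forall i, \sum_j M i j = 1)].

Definition stoch_tangent (R : realType) (k m : nat) : set 'M[R]_(k, m) :=
  [set U | forall i, \sum_j U i j = 0].

(* Injectivity of [A] together with [partition], which excludes empty blocks,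
   makes [A] an enumeration of exactly [m] pairwise disjoint nonempty blocks. *)
Definition block_enumeration (m n : nat) (A : 'I_m -> {set 'I_n}) : Prop :=
  injective A /\ finset.partition [set A i | i : 'I_m]%SET [set: 'I_n]%SET.

Definition stochastic_partition_matrix (R : realType) (m n : nat)
    (Q : 'M[R]_(m, n)) : Prop :=
  (forall i j, 0 <= Q i j) /\
  exists2 A : 'I_m -> {set 'I_n}, block_enumeration A &
    forall i i', \sum_(j in A i') Q i j = (i == i')%:R.

Definition partition_indicator_matrix (R : realType) (k l : nat)
    (Rb : 'M[R]_(k, l)) : Prop :=
  exists2 A : 'I_k -> {set 'I_l}, block_enumeration A &
    Rb = \matrix_(i, j) (j \in A i)%:R.

Definition row_product (R : realType) (k m n : nat) (M : 'M[R]_(k, m))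
    (Q : 'I_k -> 'M[R]_(m, n)) : 'M[R]_(k, n) :=
  \matrix_(a, b) (M *m Q a) a b.

(* The set of conditional embeddings R_+^{k x m} -> R_+^{l x n}, each
   represented by its linear extension to all k x m matrices.  That the
   strictly positive matrices are mapped to strictly positive matrices forces
   the entries Q^(a)_ij with j in the i-th block to be nonzero. *)
Definition cond_embedding (R : realType) (k m l n : nat) :
    set ('M[R]_(k, m) -> 'M[R]_(l, n)) :=
  [set f | (forall M, pos_mx M -> pos_mx (f M)) /\
    exists (Rb : 'M[R]_(k, l)) (Q : 'I_k -> 'M[R]_(m, n)),
      [/\ partition_indicator_matrix Rb,
          forall i, stochastic_partition_matrix (Q i) &
          f = fun M => Rb^T *m row_product M Q] ].

(* Main.v *)
(* At the matrix whose entries are all 1/2, swapping the two columns in row 0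
   only fixes the point, negates the tangent vector (1, -1) in row 0 and fixes
   those in the other rows; invariance makes different rows orthogonal.
   Duplicating one or the other row of a 2 x 2 matrix gives maps to 3 x 2
   matrices under which (1, -1) in row 0 is sent to (1, -1) in row 0, resp. in
   rows 0 and 1.  Equating the two lengths, the tangent vector (1, -1) in row 1
   has length zero. *)
Require Import Defs.
From HB Require Import structures.
From mathcomp Require Import all_boot all_order all_algebra all_fingroup.
From mathcomp Require Import boolp classical_sets functions reals topology.
From mathcomp Require Import normedtype derive.
Set Implicit Arguments.
Unset Strict Implicit.
Unset Printing Implicit Defensive.
Import Order.TTheory GRing.Theory Num.Theory.
Import numFieldNormedType.Exports.
Local Open Scope classical_set_scope.
Local Open Scope ring_scope.

(** Fibres of any map are disjoint and cover; surjectivity makes them nonempty and pairwise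
    distinct. *)
Lemma block_enumeration_preim (m n : nat) (r : 'I_n -> 'I_m) :
  (forall i, exists j, r j = i) ->
  block_enumeration (fun i => [set j | r j == i]%SET).
Proof.
move=> r_surj; split=> [i i' eq_ii'|].
  have [j rj] := r_surj i.
  have : j \in [set j | r j == i']%SET by rewrite -eq_ii' inE rj.
  by rewrite inE rj => /eqP.
apply/and3P; split.
- rewrite finset.eqEsubset finset.subsetT /=; apply/fintype.subsetP => j _.
  apply/finset.bigcupP; exists [set j' | r j' == r j]%SET; last by rewrite inE.
  exact: imset_f.
- apply/finset.trivIsetP => _ _ /imsetP[i _ ->] /imsetP[i' _ ->] neq_ii'.
  rewrite disjoint_subset; apply/fintype.subsetP => j; rewrite !inE => /eqP rj.
  by apply: contraNneq neq_ii' => rj'; rewrite -rj rj'.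
- apply/imsetP => -[i _ /setP eq0]; have [j rj] := r_surj i.
  by have := eq0 j; rewrite !inE rj eqxx.
Qed.

Lemma stochastic_partition_perm_mx (R : realType) (m : nat) (s : 'S_m) :
  stochastic_partition_matrix (perm_mx s : 'M[R]_m).
Proof.
split=> [i j|]; first by rewrite !mxE ler0n.
(* The blocks are the singletons of the [s i], written as fibres of the inverse permutation so that
   [block_enumeration_preim] applies. *)
exists (fun i => [set j | (s^-1)%g j == i]%SET).
  by apply: block_enumeration_preim => i; exists (s i); rewrite permK.
move=> i i'; under eq_bigl => j do rewrite inE (canF_eq (permKV s)).
by rewrite big_pred1_eq !mxE (inj_eq perm_inj).
Qed.

Section PermDup.
Variables (R : realType) (k l m : nat) (r : 'I_l -> 'I_k) (s : 'I_k -> 'S_m).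

(** A conditional embedding with [n = m]: the columns of row [a] are permuted by [s a], then rows
    are duplicated along [r]. The entrywise form makes linearity and continuity immediate. *)
Definition perm_dup (M : 'M[R]_(k, m)) : 'M[R]_(l, m) :=
  \matrix_(i, j) M (r i) (s (r i) j).

Lemma perm_dup_is_linear : linear perm_dup.
Proof. by move=> a M N; apply/matrixP => i j; rewrite !mxE. Qed.

HB.instance Definition _ := GRing.isLinear.Build R 'M[R]_(k, m) 'M[R]_(l, m) _
  perm_dup perm_dup_is_linear.

Lemma perm_dup_continuous : continuous perm_dup.
Proof.
(* Each entry of the image is an entry of the argument, so a ball is mapped into the ball of the
   same radius. *)
move=> M A /nbhs_ballP[e e_gt0 eA]; apply/nbhs_ballP; exists e => // N [_ MN].
by apply: eA; split=> // i j; rewrite !mxE; exact: MN.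
Qed.

Lemma diff_perm_dup (M : 'M[R]_(k, m)) :
  'd perm_dup M = perm_dup :> ('M[R]_(k, m) -> 'M[R]_(l, m)).
Proof. exact/diff_lin/perm_dup_continuous. Qed.

Lemma cond_embedding_perm_dup :
  (forall i, exists j, r j = i) -> cond_embedding perm_dup.
Proof.
move=> r_surj; split=> [M M_gt0 i j|]; first by rewrite mxE; exact: M_gt0.
(* The inverse appears because [col_perm s M] is [M] times the permutation matrix of the inverse of
   [s]. *)
exists (\matrix_(i, j) (r j == i)%:R), (fun i => perm_mx (s i)^-1); split.
- exists (fun i => [set j | r j == i]%SET).
    exact: block_enumeration_preim.
  by apply/matrixP => i j; rewrite !mxE inE.
- by move=> i; exact: stochastic_partition_perm_mx.
- apply/funext => M; apply/matrixP => i j; rewrite !mxE (bigD1 (r i)) //=.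
  rewrite big1 ?addr0 => [|a a_neq]; last first.
    by rewrite !mxE eq_sym (negPf a_neq) mul0r.
  have /matrixP/(_ (r i) j) := col_permE (s (r i)) M.
  by rewrite !mxE eqxx mul1r => <-.
Qed.

End PermDup.

Section Obstruction.
(** [E] and [T] stay abstract so that one argument covers both halves of the theorem; it only uses
    two-column matrices, at the uniform point and along directions with zero row sums. *)
Variables (R : realType) (E T : forall k m : nat, set 'M[R]_(k, m)).
Variable g : forall k m : nat,
  'M[R]_(k, m) -> 'M[R]_(k, m) -> 'M[R]_(k, m) -> R.
Hypothesis uniform_E : forall k, E (const_mx 2^-1 : 'M[R]_(k, 2)).
Hypothesis row_sum0_T : forall k, @stoch_tangent R k 2 `<=` @T k 2.
Hypothesis metric_g : forall k m, (1 <= k)%N -> (2 <= m)%N ->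
  riemannian_metric (@E k m) (@T k m) (@g k m).
Hypothesis isometry_g : forall (k m l n : nat)
    (f : 'M[R]_(k, m) -> 'M[R]_(l, n)),
  (1 <= k)%N -> (2 <= m)%N -> cond_embedding f ->
  is_isometry (@E k m) (@T k m) (@g k m) (@g l n) f.

Let diff_rows (k : nat) (c : 'I_k -> R) : 'M[R]_(k, 2) :=
  \matrix_(i, j) (c i * (-1) ^+ j).

Let T_diff_rows (k : nat) (c : 'I_k -> R) : T (diff_rows c).
Proof.
apply: row_sum0_T => i; rewrite big_ord_recl big_ord1 !mxE /=.
by rewrite expr0 expr1 mulr1 mulrN1 subrr.
Qed.

(** The metric at the uniform matrix, read as a bilinear form on the coefficients of the vectors (1,
    -1) in the various rows. *)
Let B (k : nat) (c d : 'I_k -> R) : R :=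
  g (const_mx 2^-1) (diff_rows c) (diff_rows d).

(** Writing [k.+1] settles the side condition of [metric_g] that there is at least one row. *)
Let BDZl (k : nat) (a : R) (c d e : 'I_k.+1 -> R) :
  B (fun i => a * c i + d i) e = a * B c e + B d e.
Proof.
rewrite /B -(metric_linear (metric_g _ _)) //; congr (g _ _ _).
by apply/matrixP => i j; rewrite !mxE mulrDl mulrA.
Qed.

Let BC (k : nat) (c d : 'I_k.+1 -> R) : B c d = B d c.
Proof. by rewrite /B (Defs.metric_sym (metric_g _ _)). Qed.

Let BDZr (k : nat) (a : R) (c d e : 'I_k.+1 -> R) :
  B e (fun i => a * c i + d i) = a * B e c + B e d.
Proof. by rewrite BC BDZl ![B _ e]BC. Qed.

Let B_gt0 (k : nat) (c : 'I_k.+1 -> R) i : c i != 0 -> 0 < B c c.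
Proof.
move=> ci; rewrite /B (metric_gt0 (metric_g _ _)) //.
(* Column 0 of [diff_rows c] is [c] itself. *)
apply: contraNneq ci => /matrixP/(_ i 0); rewrite !mxE expr0 mulr1.
by move=> ->.
Qed.

Let swap_if (b : bool) : 'S_2 := if b then tperm 0 1 else 1%g.

(** The map [perm_dup] fixes the uniform matrix up to its number of rows and is its own
    differential, while a column swap negates (1, -1). Isometry thus becomes invariance of [B] under
    signed pullback along [r]. *)
Let B_perm_dup (k l : nat) (r : 'I_l -> 'I_k.+1) (b : 'I_k.+1 -> bool) c d :
  (forall i, exists j, r j = i) ->
  B c d = B (fun i => (-1) ^+ b (r i) * c (r i))
            (fun i => (-1) ^+ b (r i) * d (r i)).
Proof.
move=> r_surj; pose f := perm_dup (R := R) r (swap_if \o b).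
have f_diff e :
    f (diff_rows e) = diff_rows (fun i => (-1) ^+ b (r i) * e (r i)).
  apply/matrixP => i j; rewrite !mxE /= /swap_if.
  case: (b (r i)); last by rewrite perm1 expr0 mul1r.
  rewrite expr1 mulN1r; have [->|->] : j = 0 \/ j = 1.
  - by case: j => [[|[|//]] ?]; [left|right]; exact/val_inj.
  - by rewrite tpermL expr0 mulr1 expr1 mulrN1.
  - by rewrite tpermR expr0 mulr1 expr1 mulrN1 opprK.
have f_emb := cond_embedding_perm_dup R (swap_if \o b) r_surj.
rewrite /B (isometry_g _ _ f_emb) //.
rewrite diff_perm_dup -/f !f_diff; congr (g _ _ _).
by apply/matrixP => i j; rewrite !mxE.
Qed.

Lemma no_invariant_metrics : False.
Proof.
(* The standard basis vectors; [e 1] lives on two rows and [e 2] on three. *)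
pose e k (a i : 'I_k.+1) : R := (i == a)%:R.
have rows_orth : B (e 2 0) (e 2 1) = 0.
  have id_surj (i : 'I_3) : exists j, id j = i by exists i.
  have /eqP := B_perm_dup (fun i => i == 0) (e 2 0) (e 2 1) id_surj.
  (* Negation is put in the shape [-2 * x + x] to fit [BDZl]; the invariance then reads
     [-2 * B (e 2 0) (e 2 1) = 0]. *)
  rewrite (_ : (fun i => _ * e 2 0 i) = (fun i => -2 * e 2 0 i + e 2 0 i)).
    rewrite (_ : (fun i => _ * e 2 1 i) = e 2 1).
      by rewrite BDZl -subr_eq subrr eq_sym mulf_eq0 oppr_eq0 pnatr_eq0 => /eqP.
    apply/funext => i; rewrite /e.
    by have [->|_] := eqVneq i 0; rewrite ?expr0 ?mul1r ?mulr0.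
  apply/funext => i; rewrite /e; have [_|_] := eqVneq i 0.
    by rewrite expr1 !mulr1 -addn1 natrD opprD addrNK.
  by rewrite !mulr0 addr0.
have dup (r : 'I_3 -> 'I_2) : (forall i, exists j, r j = i) ->
    B (e 1 0) (e 1 0) = B (fun i => e 1 0 (r i)) (fun i => e 1 0 (r i)).
  move=> /(B_perm_dup (fun=> false) (e 1 0) (e 1 0)) ->.
  by congr B; apply/funext => i; rewrite expr0 mul1r.
(* Row 1 is duplicated, so [e 1 0] pulls back to [e 2 0]. *)
have := dup (fun i => if i == 0 then 0 else 1) _.
rewrite (_ : (fun i => _) = e 2 0) => [dup0|]; last first.
  by apply/funext => i; rewrite /e; case: (i == 0).
(* Row 0 is duplicated, so [e 1 0] pulls back to the sum of [e 2 0] and [e 2 1]; the factor 1 again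
   fits [BDZl]. *)
have := dup (fun i => if i == 2 then 1 else 0) _.
rewrite (_ : (fun i => _) = (fun i => 1 * e 2 0 i + e 2 1 i)); last first.
  apply/funext => i; rewrite /e mul1r.
  by case: i => [[|[|[|//]]] ?]; rewrite /= ?addr0 ?add0r.
rewrite dup0 => [dup2|i]; last first.
  by case: i => [[|[|//]] ?]; [exists 0|exists 1]; exact/val_inj.
(* Pythagoras: the cross terms vanish by [rows_orth]. Cancelling leaves length zero for [e 2 1],
   against [B_gt0] at row 1. *)
have /eqP : B (e 2 0) (e 2 0) = B (e 2 0) (e 2 0) + B (e 2 1) (e 2 1).
  rewrite {1}dup2 => [|i]; last first.
    by case: i => [[|[|//]] ?]; [exists 0|exists 2]; exact/val_inj.
  by rewrite BDZl !BDZr [B (e 2 1) (e 2 0)]BC rows_orth !mul1r addr0 add0r.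
rewrite addrC -subr_eq subrr eq_sym gt_eqF //.
by apply: (B_gt0 (i := 1)); rewrite /e eqxx oner_neq0.
Qed.

End Obstruction.

Theorem theorem12 (R : realType) :
  (~ exists g : forall k m : nat,
         'M[R]_(k, m) -> 'M[R]_(k, m) -> 'M[R]_(k, m) -> R,
       (forall k m : nat, (1 <= k)%N -> (2 <= m)%N ->
          riemannian_metric (@pos_mx R k m) setT (g k m)) /\
       (forall (k m l n : nat) (f : 'M[R]_(k, m) -> 'M[R]_(l, n)),
          (1 <= k)%N -> (2 <= m)%N -> @cond_embedding R k m l n f ->
          is_isometry (@pos_mx R k m) setT (g k m) (g l n) f)) /\
  (~ exists g : forall k m : nat,
         'M[R]_(k, m) -> 'M[R]_(k, m) -> 'M[R]_(k, m) -> R,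
       (forall k m : nat, (1 <= k)%N -> (2 <= m)%N ->
          riemannian_metric (@stoch_int R k m) (@stoch_tangent R k m)
            (g k m)) /\
       (forall (k m l n : nat) (f : 'M[R]_(k, m) -> 'M[R]_(l, n)),
          (1 <= k)%N -> (2 <= m)%N -> @cond_embedding R k m l n f ->
          is_isometry (@stoch_int R k m) (@stoch_tangent R k m)
            (g k m) (g l n) f)).
Proof.
split=> -[g [metric_g isometry_g]].
  apply: (no_invariant_metrics (T := fun k m => setT) _ _ metric_g isometry_g).
    by move=> k i j; rewrite mxE invr_gt0 ltr0n.
  by [].
apply: (no_invariant_metrics _ _ metric_g isometry_g) => k;
  last exact: subset_refl.
split=> [i j|i]; first by rewrite mxE invr_gt0 ltr0n.
(* With two columns, the entries 1/2 of a row sum to 1. *)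
under eq_bigr do rewrite mxE.
by rewrite sumr_const card_ord -[LHS]mulr_natr mulVf ?pnatr_eq0.
Qed.
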